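(* Let $r\ge 1$ be an integer. Then \[ \sum_{P} x^{\mathrm{wlr}(P)}\, z^{|P|} \;=\; z^{r+1}\, x\, C(r-1)\prod_{h=1}^{r}E(h,x,z), \] where the sum runs over all Dyck paths $P$ of height exactly $r$, $|P|$ is the length (number of steps) of $P$, $\mathrm{wlr}(P)$ is the number of weak left to right maxima of $P$, and $E(h,x,z)=\dfrac{1}{1-x z^2 A(h-1)}$.
   Context: A Dyck path of semi-length $n$ is a lattice path from $(0,0)$ to $(2n,0)$ with $n$ up steps $(1,1)$ and $n$ down steps $(1,-1)$ never going below the $x$-axis; its length is $2n$ and its height is the maximal $y$-coordinate attained. A peak is an up step immediately followed by a down step, and its height is the height of its top point. A weak left to right maximum is a peak whose height is greater than or equal to the heights of all peaks to its left. Put $\lambda_1=\frac{1+\sqrt{1-4z^2}}{2}$, $\lambda_2=\frac{1-\sqrt{1-4z^2}}{2}$, and for integers $h\ge 0$ \[ C(h)=\frac{z^h\sqrt{1-4z^2}}{\lambda_1^{h+2}-\lambda_2^{h+2}},\qquad A(h)=\frac{\lambda_1^{h+1}-\lambda_2^{h+1}}{\lambda_1^{h+2}-\lambda_2^{h+2}}, \] regarded as power series in $z$ ($A(h)$ is the generating function by length of Dyck paths of height at most $h$; $C(h)$ that of paths with up and down steps staying in $0\le y\le h$, starting at $0$ and ending at height $h$). The identity is one of formal power series in $z$ with coefficients polynomial in $x$. *)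

(* Defs.v *)
From HB Require Import structures.
From mathcomp Require Import all_boot all_order all_algebra.
From mathcomp Require Import boolp.

Set Implicit Arguments.
Unset Strict Implicit.
Unset Printing Implicit Defensive.

Import Order.TTheory GRing.Theory Num.Theory.
Local Open Scope ring_scope.

Record fps (R : Type) := Fps { fps_coef :> nat -> R }.

HB.instance Definition _ (R : Type) := gen_eqMixin (fps R).
HB.instance Definition _ (R : Type) := gen_choiceMixin (fps R).

Lemma fpsP (R : Type) (f g : fps R) : (forall n, f n = g n) -> f = g.
Proof. by case: f g => [f] [g] /= /funext ->. Qed.

(* The sequence [a] with [a n = step [:: a 0; ...; a n.-1]]. *)
Fixpoint course (R : Type) (step : seq R -> R) (n : nat) : seq R :=
  if n is m.+1 then rcons (course step m) (step (course step m)) else [::].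

Definition course_of_values (R : Type) (step : seq R -> R) (n : nat) : R :=
  step (course step n).

Lemma courseE (R : Type) (step : seq R -> R) n :
  course step n = mkseq (course_of_values step) n.
Proof. by elim: n => // n IHn; rewrite /= mkseqS -IHn. Qed.

Section FpsZmodule.
Variable R : zmodType.

Definition fps_zero : fps R := Fps (fun=> 0).
Definition fps_opp (f : fps R) : fps R := Fps (fun n => - f n).
Definition fps_add (f g : fps R) : fps R := Fps (fun n => f n + g n).

Fact fps_addA : associative fps_add.
Proof. by move=> f g h; apply: fpsP => n /=; rewrite addrA. Qed.
Fact fps_addC : commutative fps_add.
Proof. by move=> f g; apply: fpsP => n /=; rewrite addrC. Qed.
Fact fps_add0 : left_id fps_zero fps_add.
Proof. by move=> f; apply: fpsP => n /=; rewrite add0r. Qed.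
Fact fps_addN : left_inverse fps_zero fps_opp fps_add.
Proof. by move=> f; apply: fpsP => n /=; rewrite addNr. Qed.

HB.instance Definition _ :=
  GRing.isZmodule.Build (fps R) fps_addA fps_addC fps_add0 fps_addN.

End FpsZmodule.

Section FpsRing.
Variable R : comNzRingType.

Definition fpsC (c : R) : fps R := Fps (fun n => if n == 0%N then c else 0).
Definition fpsX : fps R := Fps (fun n => (n == 1%N)%:R).
Definition fps_mul (f g : fps R) : fps R :=
  Fps (fun n => \sum_(i < n.+1) f i * g (n - i)%N).

Definition fps_trunc (n : nat) (f : fps R) : {poly R} := \poly_(i < n) f i.

Lemma fps_mul_trunc n m (f g : fps R) : (m < n)%N ->
  fps_mul f g m = (fps_trunc n f * fps_trunc n g)`_m.
Proof.
move=> lt_mn; rewrite coefM; apply: eq_bigr => i _.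
have le_im : (i <= m)%N by rewrite -ltnS.
by rewrite !coef_poly (leq_ltn_trans le_im) // (leq_ltn_trans (leq_subr i m)).
Qed.

Fact fps_mulC : commutative fps_mul.
Proof.
by move=> f g; apply: fpsP => n; rewrite !(fps_mul_trunc _ _ (ltnSn n)) mulrC.
Qed.

Fact fps_mulA : associative fps_mul.
Proof.
move=> f g h; apply: fpsP => n.
have tr (a b c : fps R) :
  fps_mul (fps_mul a b) c n
    = (fps_trunc n.+1 a * fps_trunc n.+1 b * fps_trunc n.+1 c)`_n.
  rewrite coefM; apply: eq_bigr => i _.
  by rewrite coef_poly ltnS leq_subr (fps_mul_trunc _ _ (ltn_ord i)).
by rewrite (fps_mulC f) !tr mulrC mulrA.
Qed.

Fact fps_mul1 : left_id (fpsC 1) fps_mul.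
Proof.
move=> f; apply: fpsP => n /=.
rewrite big_ord_recl /= mul1r subn0 big1 ?addr0 // => i _.
by rewrite mul0r.
Qed.

Fact fps_mulDl : left_distributive fps_mul (@fps_add R).
Proof.
move=> f g h; apply: fpsP => n /=.
by rewrite -big_split; apply: eq_bigr => i _; rewrite mulrDl.
Qed.

Fact fps_one_neq0 : fpsC 1 != 0 :> fps R.
Proof.
apply/eqP => /(congr1 (fun f : fps R => f 0%N)) /= /eqP.
by rewrite oner_eq0.
Qed.

HB.instance Definition _ := GRing.Zmodule_isComNzRing.Build (fps R)
  fps_mulA fps_mulC fps_mul1 fps_mulDl fps_one_neq0.

Lemma coef_fps0 n : (0 : fps R) n = 0. Proof. by []. Qed.
Lemma coef_fpsN (f : fps R) n : (- f) n = - f n. Proof. by []. Qed.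
Lemma coef_fpsD (f g : fps R) n : (f + g) n = f n + g n. Proof. by []. Qed.
Lemma coef_fps1 n : (1 : fps R) n = (n == 0%N)%:R. Proof. by case: n. Qed.
Lemma coef_fpsM (f g : fps R) n :
  (f * g) n = \sum_(i < n.+1) f i * g (n - i)%N.
Proof. by []. Qed.
Lemma coef0_fpsM (f g : fps R) : (f * g) 0%N = f 0%N * g 0%N.
Proof. by rewrite coef_fpsM big_ord1. Qed.

End FpsRing.

Section FpsUnitRing.
Variable R : comUnitRingType.

(* The units are the series whose constant coefficient is a unit; the inverse
   is obtained by solving [f * g = 1] for the successive coefficients of [g]. *)
Definition fps_unit : {pred fps R} := [pred f : fps R | f 0%N \is a GRing.unit].

Definition fps_inv_step (f : fps R) (s : seq R) : R :=
  (f 0%N)^-1 * ((size s == 0%N)%:R - \sum_(i < size s) s`_i * f (size s - i)%N).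

Definition fps_inv (f : fps R) : fps R :=
  if f \in fps_unit then Fps (course_of_values (fps_inv_step f)) else f.

Fact fps_mulVf : {in fps_unit, left_inverse 1 fps_inv *%R}.
Proof.
move=> f Uf; rewrite /fps_inv Uf; apply: fpsP => n.
set g := course_of_values _; rewrite coef_fpsM coef_fps1 big_ord_recr /= subnn.
have -> : g n = (f 0%N)^-1 * ((n == 0%N)%:R - \sum_(i < n) g i * f (n - i)%N).
  rewrite {1}/g /course_of_values /fps_inv_step courseE size_mkseq -/g.
  by under eq_bigr => i _ do rewrite nth_mkseq //.
by rewrite mulrAC mulVr // mul1r addrC subrK.
Qed.

Fact fps_unitPl (f g : fps R) : g * f = 1 -> f \in fps_unit.
Proof.
move=> /(congr1 (fun h : fps R => h 0%N)); rewrite coef0_fpsM coef_fps1 => gf1.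
by apply/unitrPr; exists (g 0%N); rewrite mulrC.
Qed.

Fact fps_inv_out : {in [predC fps_unit], fps_inv =1 id}.
Proof. by move=> f /negPf; rewrite /fps_inv inE /= => ->. Qed.

HB.instance Definition _ := GRing.ComNzRing_hasMulInverse.Build (fps R)
  fps_mulVf fps_unitPl fps_inv_out.

Lemma fps_unitE (f : fps R) :
  (f \is a GRing.unit) = (f 0%N \is a GRing.unit).
Proof. by []. Qed.

(* The square root with constant coefficient 1 of a series [f] with constant
   coefficient 1, when 2 is invertible (see [fps_sqrt0] and [sqr_fps_sqrt]). *)
Definition fps_sqrt_step (f : fps R) (s : seq R) : R :=
  if size s == 0%N then 1
  else (f (size s) - \sum_(1 <= i < size s) s`_i * s`_(size s - i)) / 2%:R.

Definition fps_sqrt (f : fps R) : fps R :=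
  Fps (course_of_values (fps_sqrt_step f)).

Lemma fps_sqrt0 (f : fps R) : fps_sqrt f 0%N = 1.
Proof. by []. Qed.

Lemma sqr_fps_sqrt (f : fps R) : (2%:R : R) \is a GRing.unit -> f 0%N = 1 ->
  fps_sqrt f ^+ 2 = f.
Proof.
move=> U2 f0; apply: fpsP => n; rewrite expr2.
set g := fps_sqrt f; case: n => [|n]; first by rewrite coef0_fpsM mulr1 f0.
have gE : g n.+1 = (f n.+1 - \sum_(i < n) g i.+1 * g (n - i)%N) / 2%:R.
  rewrite {1}/g /= {1}/course_of_values {1}/fps_sqrt_step courseE size_mkseq /=.
  congr ((_ - _) / _); rewrite big_add1 /= big_mkord; apply: eq_bigr => i _.
  have [lt_in lt_ni] : (i.+1 < n.+1)%N /\ (n - i < n.+1)%N.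
    by rewrite !ltnS leq_subr ltn_ord.
  by rewrite subSS nth_mkseq // (nth_map 0%N) ?size_iota ?nth_iota ?ltn_ord.
have g0 : g 0%N = 1 by [].
clearbody g; rewrite coef_fpsM big_ord_recl big_ord_recr /= subnn subn0.
rewrite g0 mul1r mulr1 addrCA -mulr2n -[_ *+ 2]mulr_natr.
by rewrite gE divrK // addrC subrK.
Qed.

End FpsUnitRing.

Lemma coef_fpsXn (R : comNzRingType) k n : (fpsX R ^+ k) n = (n == k)%:R.
Proof.
elim: k n => [|k IHk] n; first by rewrite expr0 coef_fps1.
rewrite exprS coef_fpsM big_ord_recl /= mul0r add0r; case: n => [|n].
  by rewrite big_ord0.
rewrite big_ord_recl /= mul1r big1 ?addr0 => [|i _]; last by rewrite mul0r.
by rewrite IHk eqSS /bump /= subSS subn0.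
Qed.

Lemma fpsC_exp (R : comNzRingType) (c : R) k : fpsC c ^+ k = fpsC (c ^+ k).
Proof.
elim: k => [|k IHk]; first by rewrite !expr0.
rewrite !exprS IHk; apply: fpsP => n; rewrite coef_fpsM big_ord_recl /= subn0.
by rewrite big1 ?addr0 => [|i _]; [case: n => //= n; rewrite mulr0 | rewrite mul0r].
Qed.

(* A path is its sequence of steps: [true] is the up step (1,1) and [false] the
   down step (1,-1). Its length is its [size]. *)
Definition path_word := seq bool.

Definition ordinate (P : path_word) (i : nat) : int :=
  (count_mem true (take i P))%:Z - (count_mem false (take i P))%:Z.

Definition is_dyck (P : path_word) : bool :=
  (count_mem true P == count_mem false P)
  && [forall i : 'I_(size P).+1, 0 <= ordinate P i].

Definition path_height (P : path_word) : int :=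
  \big[Order.max/0]_(i < (size P).+1) ordinate P i.

(* The steps number [i] and [i.+1] (counted from 0) form a peak, whose top is
   the point with abscissa [i.+1]. *)
Definition is_peak (P : path_word) (i : nat) : bool :=
  [&& (i.+1 < size P)%N, nth false P i == true & nth false P i.+1 == false].

Definition peak_height (P : path_word) (i : nat) : int := ordinate P i.+1.

Definition is_weak_ltr_max (P : path_word) (i : nat) : bool :=
  is_peak P i &&
  [forall j : 'I_i, is_peak P j ==> (peak_height P j <= peak_height P i)].

Definition wlr (P : path_word) : nat :=
  #|[set i : 'I_(size P) | is_weak_ltr_max P i]|.

(* The sum of the series [F P] over all the paths [P] satisfying [D], for a
   family in which [F P] is divisible by z^|P|: the coefficient of z^n then only
   involves the finitely many paths of length at most [n]. *)
Definition path_sum (R : comNzRingType) (D : pred path_word)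
    (F : path_word -> fps R) : fps R :=
  Fps (fun n => \sum_(k < n.+1) \sum_(P : k.-tuple bool | D P) F P n).

Lemma coef_path_sum (R : comNzRingType) (D : pred path_word) (c : R)
    (w : path_word -> nat) n :
  path_sum D (fun P => fpsC c ^+ w P * fpsX R ^+ size P) n
    = \sum_(P : n.-tuple bool | D P) c ^+ w P.
Proof.
have FE P : (fpsC c ^+ w P * fpsX R ^+ size P) n
    = if n == size P then c ^+ w P else 0.
  rewrite fpsC_exp coef_fpsM big_ord_recl /= subn0 coef_fpsXn.
  rewrite big1 ?addr0 => [|i _]; last by rewrite mul0r.
  by case: eqP; rewrite ?mulr1 ?mulr0.
transitivity (\sum_(k < n.+1) \sum_(P : k.-tuple bool | D P)
                 if n == size P then c ^+ w P else 0).
  by apply: eq_bigr => k _; apply: eq_bigr => P _; rewrite FE.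
rewrite big_ord_recr /= big1 ?add0r => [|k _]; last first.
  by apply: big1 => P _; rewrite size_tuple gtn_eqF.
by apply: eq_bigr => P _; rewrite size_tuple eqxx.
Qed.

Definition x : fps {poly rat} := fpsC 'X.
Definition z : fps {poly rat} := fpsX {poly rat}.

Definition sqrt_1m4z2 : fps {poly rat} := fps_sqrt (1 - 4%:R * z ^+ 2).

Lemma unit2_polyrat : (2%:R : {poly rat}) \is a GRing.unit.
Proof. by rewrite -polyC_natr poly_unitE coefC size_polyC. Qed.

Lemma sqr_sqrt_1m4z2 : sqrt_1m4z2 ^+ 2 = 1 - 4%:R * z ^+ 2.
Proof.
apply: sqr_fps_sqrt unit2_polyrat _.
by rewrite coef_fpsD coef_fpsN coef0_fpsM coef_fpsXn mulr0 subr0.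
Qed.

Definition lambda1 : fps {poly rat} := (1 + sqrt_1m4z2) / 2%:R.
Definition lambda2 : fps {poly rat} := (1 - sqrt_1m4z2) / 2%:R.

(* The series that are inverted in [C], [A] and [E] are units of
   [fps {poly rat}]: see [lambda_denom_unit] and [E_denom_unit]. *)
Definition C (h : nat) : fps {poly rat} :=
  z ^+ h * sqrt_1m4z2 / (lambda1 ^+ (h + 2) - lambda2 ^+ (h + 2)).

Definition A (h : nat) : fps {poly rat} :=
  (lambda1 ^+ (h + 1) - lambda2 ^+ (h + 1))
  / (lambda1 ^+ (h + 2) - lambda2 ^+ (h + 2)).

Definition E (h : nat) : fps {poly rat} := (1 - x * z ^+ 2 * A (h - 1))^-1.

Lemma unit2_fps : (2%:R : fps {poly rat}) \is a GRing.unit.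
Proof. rewrite fps_unitE; exact: unit2_polyrat. Qed.

Lemma lambda_denom_unit h :
  lambda1 ^+ (h + 2) - lambda2 ^+ (h + 2) \is a GRing.unit.
Proof.
have e0 (f : fps {poly rat}) k : (f ^+ k) 0%N = f 0%N ^+ k.
  by elim: k => [|k IHk]; rewrite ?expr0 // !exprS coef0_fpsM IHk.
have l1 : lambda1 0%N = 1.
  apply: (mulIr unit2_polyrat); rewrite mul1r.
  by rewrite -[2%:R in LHS]/((2%:R : fps {poly rat}) 0%N) -coef0_fpsM divrK ?unit2_fps.
have l2 : lambda2 0%N = 0.
  apply: (mulIr unit2_polyrat); rewrite mul0r.
  rewrite -[2%:R in LHS]/((2%:R : fps {poly rat}) 0%N) -coef0_fpsM divrK ?unit2_fps //.
  by rewrite coef_fpsD coef_fpsN fps_sqrt0 subrr.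
rewrite fps_unitE coef_fpsD coef_fpsN !e0 l1 l2 expr1n addn2 expr0n subr0.
exact: unitr1.
Qed.

Lemma E_denom_unit h : 1 - x * z ^+ 2 * A h \is a GRing.unit.
Proof.
rewrite fps_unitE coef_fpsD coef_fpsN coef0_fpsM (coef0_fpsM x) coef_fpsXn mulr0 mul0r subr0.
exact: unitr1.
Qed.

(* Main.v *)
(* Read from left to right, a Dyck path is at each time described by its current
   height y and by the largest ordinate m seen so far. A peak is a weak left to
   right maximum exactly when its down step starts at height y = m, so the
   generating functions F(m, y) of the possible continuations satisfy
     F(m, y) = [y = 0 and m = r] + z F(max(m, y + 1), y + 1)
               + [y > 0] x^[y = m] z F(m, y - 1).
   For fixed m this is a three term recurrence in y, solved by
   D(k) = (lambda1^k - lambda2^k) / (lambda1 - lambda2); eliminating F(m, 0)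
   with Cassini's identity D(k+1)^2 - D(k) D(k+2) = z^(2k) gives
     F(m, m - 1) = z A(m - 1) F(m, m) + [m = r] C(m - 1),
   whence F(m, m) = z E(m) (F(m + 1, m + 1) + [m = r] x C(m - 1)). Since F(m, _) = 0
   for m > r, the formula follows by descending from m = r to F(0, 0). *)
Require Import Defs.
From mathcomp Require Import all_boot all_order all_algebra.
From mathcomp Require Import ring zify.
Import Order.TTheory GRing.Theory Num.Theory.
Local Open Scope ring_scope.

(** * Step-by-step reading of a path *)

Definition step (b : bool) : int := if b then 1 else - 1.

Lemma ordinate0 P : ordinate P 0 = 0.
Proof. by rewrite /ordinate take0. Qed.

Lemma ordinate_cons b P i : ordinate (b :: P) i.+1 = step b + ordinate P i.
Proof. by rewrite /ordinate /step /=; case: b => /=; lia. Qed.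

Lemma ordinateS P i : (i < size P)%N ->
  ordinate P i.+1 = ordinate P i + step (nth false P i).
Proof.
elim: P i => [//|b P IH] [_|i lt_iP] /=; rewrite ordinate_cons.
  by rewrite !ordinate0 addr0 add0r.
by rewrite IH // ordinate_cons addrA.
Qed.

(* [P] is read as the rest of a path that has reached height [y], with [m] the
   largest ordinate so far; [r] is the height prescribed for the whole path. *)
Fixpoint dyck_from (r m y : nat) (P : path_word) : bool :=
  match P with
  | [::] => (y == 0%N) && (m == r)
  | true :: P' => dyck_from r (maxn m y.+1) y.+1 P'
  | false :: P' => (0 < y)%N && dyck_from r m y.-1 P'
  end.

(** In a Dyck path a down step from the running maximum always follows an up step, so these peaks
    are counted without remembering the previous step. *)
Fixpoint max_descents (m y : nat) (P : path_word) : nat :=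
  match P with
  | [::] => 0%N
  | true :: P' => max_descents (maxn m y.+1) y.+1 P'
  | false :: P' => ((y == m) + max_descents m y.-1 P')%N
  end.

Lemma forall_ordS n (B : pred 'I_n.+1) :
  [forall i, B i] = B ord0 && [forall i : 'I_n, B (lift ord0 i)].
Proof.
apply/forallP/andP => [B_ | [B0 /forallP BS] i]; first by split=> //; apply/forallP.
by case: (unliftP ord0 i) => [j ->|->].
Qed.

(** Removing the first step moves the starting ordinate to [y + step b]; as [y <= m], the point left
    behind does not affect the maximum. *)
Lemma dyck_fromE r m y P : (y <= m)%N ->
  dyck_from r m y P =
  [&& (y + count_mem true P == count_mem false P)%N,
      [forall i : 'I_(size P).+1, 0 <= y%:Z + ordinate P i] &
      Order.max m%:Z (\big[Order.max/0]_(i < (size P).+1) (y%:Z + ordinate P i))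
        == r%:Z].
Proof.
elim: P m y => [|b P IH] m y le_ym.
  rewrite /= forall_ordS big_ord_recl big_ord0 ordinate0.
  have -> : [forall i : 'I_0, 0 <= y%:Z + ordinate [::] (lift ord0 i)] by apply/forallP=> -[].
  by case: y le_ym => [|y] le_ym //=; apply/idP/idP; lia.
have ge_big y' : y'%:Z <= \big[Order.max/0]_(i < (size P).+1) (y'%:Z + ordinate P i).
  by rewrite big_ord_recl ordinate0 addr0 le_max lexx.
have E y' : y%:Z + step b = y'%:Z ->
    [forall i : 'I_(size (b :: P)).+1, 0 <= y%:Z + ordinate (b :: P) i]
      = [forall i : 'I_(size P).+1, 0 <= y'%:Z + ordinate P i]
  /\ \big[Order.max/0]_(i < (size (b :: P)).+1) (y%:Z + ordinate (b :: P) i)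
   = Order.max y%:Z (\big[Order.max/0]_(i < (size P).+1) (y'%:Z + ordinate P i)).
  move=> yE; have ordS (i : 'I_(size P).+1) :
      y%:Z + ordinate (b :: P) (lift ord0 i) = y'%:Z + ordinate P i.
    by rewrite lift0 ordinate_cons addrA yE.
  rewrite forall_ordS big_ord_recl (eq_bigr _ (fun i _ => ordS i)) ordinate0 addr0.
  by split=> //; apply: eq_forallb => i; rewrite ordS.
case: b E => E /=.
  have [|-> ->] := E y.+1; first by rewrite /step; lia.
  rewrite IH; last by lia.
  rewrite add1n add0n addSnnS; congr [&& _, _ & _].
  by have := ge_big y.+1; lia.
case: y le_ym E => [|y] le_ym E /=.
  rewrite add0n add1n; apply/esym/negP => /and3P[_ /forallP/(_ (lift ord0 ord0))].
  by rewrite lift0 ordinate_cons ordinate0.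
have [|-> ->] := E y; first by rewrite /step; lia.
rewrite IH; last by lia.
rewrite add0n add1n addSn eqSS; congr [&& _, _ & _].
by have := ge_big y; lia.
Qed.

(** * Weak left to right maxima as descents from the maximum *)

Definition descends_from_max (m y : nat) (P : path_word) (i : nat) : bool :=
  [&& ~~ nth false P i, m%:Z <= y%:Z + ordinate P i &
      [forall j : 'I_i.+1, ordinate P j <= ordinate P i]].

(** As [y <= m], comparing with [m] covers the starting point dropped in the induction. [dyck_from]
    ensures [y > 0] before a down step, so [y.-1] is not truncated. *)
Lemma max_descentsE r m y P : (y <= m)%N -> dyck_from r m y P ->
  max_descents m y P = (\sum_(i < size P) descends_from_max m y P i)%N.
Proof.
elim: P m y => [|b P IH] m y le_ym; first by rewrite big_ord0.
rewrite [size _]/= big_ord_recl => dyckP.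
have E m' y' : y%:Z + step b = y'%:Z -> m' = maxn m y' ->
    (\sum_(i < size P) descends_from_max m y (b :: P) (lift ord0 i)
     = \sum_(i < size P) descends_from_max m' y' P i)%N.
  move=> yE mE; apply: eq_bigr => i _; congr nat_of_bool.
  rewrite lift0 /descends_from_max /= ordinate_cons addrA yE; congr (_ && _).
  apply/andP/andP => -[le_m /forallP le_j]; split.
  - have := le_j (lift ord0 ord0); rewrite lift0 ordinate_cons ordinate0; lia.
  - apply/forallP => j; have := le_j (lift ord0 j).
    by rewrite lift0 ordinate_cons lerD2l.
  - by lia.
  apply/forallP => j; case: (unliftP ord0 j) => [k ->|->].
    by rewrite lift0 ordinate_cons lerD2l; apply: le_j.
  by rewrite ordinate0; lia.
have forall1 Q : [forall j : 'I_1, ordinate Q j <= 0].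
  by apply/forallP => j; rewrite ord1 ordinate0.
case: b dyckP E => /= [dyckP|/andP[y_gt0 dyckP]] E.
  rewrite (E _ y.+1 _ erefl) ?(IH _ _ _ dyckP) //; first by lia.
  by rewrite /step; lia.
rewrite (E m y.-1) ?(IH _ _ _ dyckP) /step //; try lia.
rewrite /descends_from_max /= ordinate0 addr0 forall1 andbT.
by congr (nat_of_bool _ + _)%N; lia.
Qed.

Lemma is_dyckE r P :
  is_dyck P && (path_height P == r%:Z) = dyck_from r 0 0 P.
Proof.
rewrite dyck_fromE // add0n -andbA; congr [&& _, _ & _].
  by apply: eq_forallb => i; rewrite add0r.
rewrite /path_height; under [in RHS]eq_bigr => i _ do rewrite add0r.
by rewrite (max_idPr _) // big_ord_recl ordinate0 le_max lexx.
Qed.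

Lemma is_dyck_ge0 P i : is_dyck P -> (i <= size P)%N -> 0 <= ordinate P i.
Proof.
by case/andP=> _ /forallP nnP; rewrite -ltnS => lt_i; apply: (nnP (Ordinal lt_i)).
Qed.

(* A highest point before the top of a peak is either the origin or the top of
   another peak, so it is enough to compare with the earlier peaks. *)
Lemma is_weak_ltr_maxE P i : is_dyck P -> (i.+1 < size P)%N ->
  is_weak_ltr_max P i = descends_from_max 0 0 P i.+1.
Proof.
move=> dyckP lt_iP; have ge0P j := is_dyck_ge0 P j dyckP.
rewrite /is_weak_ltr_max /descends_from_max /is_peak lt_iP /= add0r ge0P 1?ltnW //.
have SP j : (j < size P)%N -> ordinate P j.+1 = ordinate P j + step (nth false P j).
  exact: ordinateS.
apply/andP/andP => [[/andP[/eqP upi /eqP downi] /forallP maxi]|]; last first.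
  move=> [downi /forallP maxi]; split.
    have lt_i : (i < i.+2)%N by [].
    have := maxi (Ordinal lt_i); rewrite /= SP; last by lia.
    by rewrite (negPf downi) eqxx andbT; case: nth; rewrite /step //; lia.
  apply/forallP => j; apply/implyP => _; rewrite /peak_height.
  have lt_j : (j.+1 < i.+2)%N by case: j => j /=; lia.
  exact: (maxi (Ordinal lt_j)).
rewrite downi; split=> //.
have [k _ maxk] := @arg_maxP _ _ _ (@ord0 i.+1) xpredT (fun j : 'I_i.+2 => ordinate P j) isT.
apply/forallP => j; apply: le_trans (maxk j isT) _.
rewrite leNgt; apply/negP => lt_ik.
case: k maxk lt_ik => -[|k] lt_k maxk lt_ik.
  by have := ge0P i.+1; move: lt_ik; rewrite /= ordinate0; lia.
have lt_ki : (k < i)%N.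
  rewrite ltn_neqAle -ltnS -ltnS lt_k andbT; apply/eqP => ki.
  by move: lt_ik; rewrite /= ki ltxx.
have upk : nth false P k = true.
  have := maxk (Ordinal (ltnW lt_k)) isT; rewrite /= SP; last by lia.
  by case: nth; rewrite /step //; lia.
have downk : nth false P k.+1 = false.
  have lt_k2 : (k.+2 < i.+2)%N by [].
  have := maxk (Ordinal lt_k2) isT; rewrite /= SP; last by lia.
  by case: nth; rewrite /step //; lia.
have /implyP := maxi (Ordinal lt_ki); rewrite /= upk downk !eqxx andbT.
have -> : (k.+1 < size P)%N by lia.
by move=> /(_ isT); rewrite /peak_height leNgt lt_ik.
Qed.

Lemma wlrE r P : dyck_from r 0 0 P -> wlr P = max_descents 0 0 P.
Proof.
move=> fromP; rewrite (max_descentsE r) //.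
have /andP[dyckP _] : is_dyck P && (path_height P == r%:Z) by rewrite is_dyckE.
rewrite /wlr -sum1_card (eq_bigl (fun i : 'I_(size P) => is_weak_ltr_max P i)); last first.
  by move=> i; rewrite inE.
case sP: (size P) => [|n]; first by rewrite !big_ord0.
(* A peak at [i] is a descent at [i.+1]: the last index is split off on the left, the first on the
   right, and both terms vanish. *)
rewrite big_mkcond big_ord_recr big_ord_recl /=.
have -> : is_weak_ltr_max P n = false by rewrite /is_weak_ltr_max /is_peak sP ltnn.
have -> : descends_from_max 0 0 P 0 = false.
  by case: P sP fromP {dyckP} => [|[] P].
rewrite addn0 add0n; apply: eq_bigr => i _.
by rewrite /bump leq0n add1n is_weak_ltr_maxE ?sP ?ltnS ?ltn_ord.
Qed.

(** * Series of continuations and their recurrence *)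

Lemma coef_zM (f : fps {poly rat}) n : (z * f) n = if n is n'.+1 then f n' else 0.
Proof.
rewrite coef_fpsM big_ord_recl mul0r add0r; case: n => [|n]; first by rewrite big_ord0.
rewrite big_ord_recl mul1r big1 ?addr0 ?subSS ?subn0 // => i _.
by rewrite mul0r.
Qed.

Lemma coef_xM (f : fps {poly rat}) n : (x * f) n = 'X * f n.
Proof.
rewrite coef_fpsM big_ord_recl subn0 big1 ?addr0 // => i _.
by rewrite mul0r.
Qed.

Lemma lreg_z : GRing.lreg z.
Proof.
move=> f g zfg; apply: fpsP => n.
by have := congr1 (fun h : fps _ => h n.+1) zfg; rewrite !coef_zM.
Qed.

Lemma sum_tupleS (V : nmodType) n (B : pred path_word) (F : path_word -> V) :
  \sum_(P : n.+1.-tuple bool | B P) F P =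
    \sum_(P : n.-tuple bool | B (true :: P)) F (true :: P)
    + \sum_(P : n.-tuple bool | B (false :: P)) F (false :: P).
Proof.
rewrite (reindex (fun bP : bool * n.-tuple bool => cons_tuple bP.1 bP.2)) /=; last first.
  exists (fun P : n.+1.-tuple bool => (thead P, [tuple of behead P])) => [[b P] _|P _].
    by congr (_, _); apply: val_inj.
  by apply: val_inj; case/tupleP: P.
rewrite -(pair_big_dep xpredT (fun b (P : n.-tuple bool) => B (b :: P))
  (fun b P => F (b :: P))) /=.
by rewrite big_bool.
Qed.

Definition suffix_gf (r m y : nat) : fps {poly rat} :=
  Fps (fun n => \sum_(P : n.-tuple bool | dyck_from r m y P) 'X ^+ max_descents m y P).

Lemma suffix_gfE r m y :
  suffix_gf r m y = ((y == 0%N) && (m == r))%:R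
    + z * suffix_gf r (maxn m y.+1) y.+1
    + (if y is y'.+1 then x ^+ (y == m) * (z * suffix_gf r m y') else 0).
Proof.
apply: fpsP => n; rewrite !coef_fpsD coef_zM.
have coef_down f : (x ^+ (y == m) * (z * f)) n
    = if n is n'.+1 then 'X ^+ (y == m) * f n' else 0.
  by case: (y == m); rewrite ?expr1 ?expr0 ?mul1r ?coef_xM coef_zM;
     case: n => [|n]; rewrite ?mulr0 ?mul1r.
case: n coef_down => [|n] coef_down /=.
  have -> : (if y is y'.+1 then x ^+ (y == m) * (z * suffix_gf r m y') else 0) 0%N = 0.
    by case: y coef_down => // y ->.
  rewrite !addr0 big_mkcond (big_pred1 [tuple]) => [|P]; last exact/esym/eqP/tuple0.
  by rewrite /=; case: andb.
rewrite (sum_tupleS _ n (dyck_from r m y) (fun P => 'X ^+ max_descents m y P)) /=.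
rewrite -[LHS]add0r addrA; congr (_ + _ + _).
  by case: andb.
case: y coef_down => [|y] coef_down; first by rewrite big_pred0.
by rewrite coef_down big_distrr /=; apply: eq_bigr => P _; rewrite exprD.
Qed.

Lemma path_sumE r :
  path_sum (fun P => is_dyck P && (path_height P == r%:Z))
           (fun P => x ^+ wlr P * z ^+ size P) = suffix_gf r 0 0.
Proof.
apply: fpsP => n; rewrite coef_path_sum; apply: eq_big => P; first exact: is_dyckE.
by rewrite is_dyckE => fromP; rewrite (wlrE r).
Qed.

(** The running maximum never decreases, so it cannot come back to [r]. *)
Lemma suffix_gf_gt r m y : (r < m)%N -> suffix_gf r m y = 0.
Proof.
move=> lt_rm; apply: fpsP => n; apply: big_pred0 => P.
move: (tval P) => {n}{}P; elim: P m y lt_rm => [|[] P IH] m y lt_rm /=.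
- by rewrite (gtn_eqF lt_rm) andbF.
- by apply: IH; lia.
- by rewrite IH // andbF.
Qed.

(** * The Lucas sequence behind [A] and [C] *)

Lemma lambda_sum : lambda1 + lambda2 = 1.
Proof.
rewrite /lambda1 /lambda2 -mulrDl addrACA subrr addr0.
by rewrite -[1 + 1]/(2%:R) divrr ?unit2_fps.
Qed.

Lemma lambda_diff : lambda1 - lambda2 = sqrt_1m4z2.
Proof.
apply: (mulrI unit2_fps); rewrite mulrBr ![2%:R * (_ / _)]mulrC !divrK ?unit2_fps //.
by ring.
Qed.

Lemma lambda_prod : lambda1 * lambda2 = z ^+ 2.
Proof.
have unit4 : (2%:R * 2%:R : fps {poly rat}) \is a GRing.unit by rewrite unitrM unit2_fps.
apply: (mulrI unit4); rewrite mulrACA ![2%:R * (_ / _)]mulrC !divrK ?unit2_fps //.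
by have := sqr_sqrt_1m4z2; set s := sqrt_1m4z2 => s2; ring: s2.
Qed.

Lemma sqrt_1m4z2_unit : sqrt_1m4z2 \is a GRing.unit.
Proof. by rewrite fps_unitE fps_sqrt0 unitr1. Qed.

(** This is D(k), the Lucas sequence U_k(1, z^2); its denominator is [lambda1 - lambda2] by
    [lambda_diff]. *)
Definition lucas (k : nat) : fps {poly rat} :=
  (lambda1 ^+ k - lambda2 ^+ k) / sqrt_1m4z2.

Lemma lucas0 : lucas 0 = 0.
Proof. by rewrite /lucas subrr mul0r. Qed.

Lemma lucas1 : lucas 1 = 1.
Proof. by rewrite /lucas lambda_diff divrr ?sqrt_1m4z2_unit. Qed.

(** [lambda1] and [lambda2] are the roots of t^2 - t + z^2. *)
Lemma lucasSS k : lucas k.+2 = lucas k.+1 - z ^+ 2 * lucas k.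
Proof.
rewrite /lucas -lambda_prod mulrA -mulrBl; congr (_ / _).
rewrite -[lambda1 ^+ k.+1 - _]mul1r -lambda_sum !exprS; ring.
Qed.

(** By the recurrence, passing from [k] to [k.+1] multiplies the left side by z^2. *)
Lemma lucas_cassini k : lucas k.+1 ^+ 2 - lucas k * lucas k.+2 = z ^+ (2 * k).
Proof.
elim: k => [|k IH]; first by rewrite lucas0 lucas1 expr1n mul0r subr0.
rewrite mulnS exprD -IH (lucasSS k.+1) (lucasSS k); ring.
Qed.

Lemma lambda_powE k : lambda1 ^+ k - lambda2 ^+ k = sqrt_1m4z2 * lucas k.
Proof. by rewrite /lucas mulrC divrK ?sqrt_1m4z2_unit. Qed.

Lemma lucas_unit k : lucas k.+1 \is a GRing.unit.
Proof.
case: k => [|k]; first by rewrite lucas1 unitr1.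
by rewrite /lucas unitrM unitrV sqrt_1m4z2_unit -addn2 lambda_denom_unit.
Qed.

Lemma mul_lucas_A h : lucas h.+2 * A h = lucas h.+1.
Proof.
apply: (mulrI sqrt_1m4z2_unit); rewrite mulrA -!lambda_powE /A addn1 addn2.
by rewrite mulrC divrK // -addn2 lambda_denom_unit.
Qed.

Lemma mul_lucas_C h : lucas h.+2 * C h = z ^+ h.
Proof.
apply: (mulrI sqrt_1m4z2_unit); rewrite mulrA -!lambda_powE /C addn2.
by rewrite mulrC divrK 1?mulrC // -addn2 lambda_denom_unit.
Qed.

(** * Solving the recurrence *)

Lemma suffix_gf_lucas r m y : (y <= m)%N ->
  z ^+ y * suffix_gf r m y
    = lucas y.+1 * suffix_gf r m 0 - (m == r)%:R * lucas y.
Proof.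
(* Below the maximum no x occurs, and z^y F(m, y) obeys the second order recurrence of [lucas],
   hence two consecutive values; [m = r] enters only at [y = 0]. *)
suff both k : (k < m)%N ->
    z ^+ k * suffix_gf r m k = lucas k.+1 * suffix_gf r m 0 - (m == r)%:R * lucas k
  /\ z ^+ k.+1 * suffix_gf r m k.+1
    = lucas k.+2 * suffix_gf r m 0 - (m == r)%:R * lucas k.+1.
  case: y => [|y]; last by case/both.
  by rewrite lucas0 lucas1 expr0 !mul1r mulr0 subr0.
elim: k => [|k IH] lt_km.
  split; first by rewrite lucas0 lucas1 expr0 !mul1r mulr0 subr0.
  rewrite lucasSS lucas1 lucas0 [in RHS]suffix_gfE (maxn_idPl lt_km) /=; ring.
have [IH0 IH1] := IH (ltnW lt_km); split=> //.
have := suffix_gfE r m k.+1; rewrite (maxn_idPl lt_km) (ltn_eqF lt_km) /= expr0 mul1r.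
set f0 := suffix_gf r m k; set f1 := suffix_gf r m k.+1.
set f2 := suffix_gf r m k.+2 => f1E; rewrite add0r in f1E.
have -> : z ^+ k.+2 * f2 = z ^+ k.+1 * f1 - z ^+ 2 * (z ^+ k * f0).
  by rewrite f1E !exprS; ring.
rewrite IH0 IH1 (lucasSS k.+1) (lucasSS k); ring.
Qed.

Lemma suffix_gf_below_max r m :
  suffix_gf r m.+1 m = z * A m * suffix_gf r m.+1 m.+1 + (m.+1 == r)%:R * C m.
Proof.
(* The factor D(m + 2) clears the denominators of [A] and [C], and z^m prepares for
   [suffix_gf_lucas]. *)
apply: (mulrI (lucas_unit m.+1)); apply: (@lregX _ z m lreg_z).
have := suffix_gf_lucas r m.+1 m (leqnSn m).
have := suffix_gf_lucas r m.+1 m.+1 (leqnn _).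
set f0 := suffix_gf r m.+1 0; set f := suffix_gf r m.+1 m.
set g := suffix_gf r m.+1 m.+1; set b := _%:R; rewrite exprS => gE fE.
have -> : z ^+ m * (lucas m.+2 * f) = lucas m.+2 * (z ^+ m * f) by ring.
have -> : z ^+ m * (lucas m.+2 * (z * A m * g + b * C m))
  = (lucas m.+2 * A m) * (z * z ^+ m * g) + b * z ^+ m * (lucas m.+2 * C m) by ring.
rewrite mul_lucas_A mul_lucas_C gE fE.
have -> : b * z ^+ m * z ^+ m = b * z ^+ (2 * m) by rewrite mul2n -addnn exprD mulrA.
(* The terms in F(m + 1, 0) cancel; what remains is Cassini's identity times [m + 1 = r]. *)
rewrite -lucas_cassini; ring.
Qed.

(** A down step from the maximum leads to F(m + 1, m), which contains F(m + 1, m + 1) again;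
    collecting both occurrences produces the denominator of [E m.+1]. *)
Lemma suffix_gf_at_max r m :
  suffix_gf r m.+1 m.+1
    = z * E m.+1 * (suffix_gf r m.+2 m.+2 + (m.+1 == r)%:R * x * C m).
Proof.
rewrite /E subn1 /=; apply: (mulrI (E_denom_unit m)).
set e := 1 - _; set g := suffix_gf r m.+2 m.+2.
have -> : e * (z / e * (g + (m.+1 == r)%:R * x * C m))
  = e / e * (z * (g + (m.+1 == r)%:R * x * C m)) by ring.
rewrite divrr ?E_denom_unit // mul1r /e.
have := suffix_gfE r m.+1 m.+1; rewrite (maxn_idPr (leqnSn _)) eqxx /= expr1 add0r -/g.
rewrite suffix_gf_below_max; move: (suffix_gf _ _ _) => f fE.
have -> : (1 - x * z ^+ 2 * A m) * f = f - x * z ^+ 2 * A m * f by ring.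
rewrite {1}fE; ring.
Qed.

(** Here [k] is the number of levels left to climb; at [k = 0] the series at the next level vanishes
    by [suffix_gf_gt]. *)
Lemma suffix_gf_prod m k :
  suffix_gf (m + k.+1) m.+1 m.+1
    = z ^+ k.+1 * x * C (m + k.+1 - 1) * \prod_(m.+1 <= h < (m + k.+1).+1) E h.
Proof.
elim: k m => [|k IH] m; rewrite suffix_gf_at_max.
  by rewrite suffix_gf_gt addn1 // eqxx subn1 big_nat1 /= expr1; ring.
have -> : (m.+1 == m + k.+2)%N = false by lia.
rewrite [in RHS]big_ltn; last by lia.
by rewrite -addSnnS IH (exprS z k.+1) !mul0r addr0; set P := \prod_(_ <= _ < _) _; ring.
Qed.

Theorem theorem6 (r : nat) (r_ge1 : (1 <= r)%N) :
  path_sum (fun P => is_dyck P && (path_height P == r%:Z))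
           (fun P => x ^+ wlr P * z ^+ size P)
  = z ^+ (r + 1) * x * C (r - 1) * \prod_(1 <= h < r.+1) E h.
Proof.
(* As [r >= 1], the path is nonempty and starts with an up step to the state (1, 1), which gives the
   extra factor z. *)
rewrite path_sumE suffix_gfE (ltn_eqF r_ge1) add0r addr0 /= max0n.
case: r r_ge1 => // r _; have := suffix_gf_prod 0 r; rewrite add0n => ->.
by rewrite addn1 (exprS z r.+1) !mulrA.
Qed.
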